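(* Let $k\ge 2$ and $r\ge 2$ be integers and $n=k^2$. If there exists a $2$-$(k^2,k,1)$ resolvable packing with at least $r$ parallel classes, then $\theta^{c}(\mathcal{K}_{n^{[r]}})=2n$, where $\mathcal{K}_{n^{[r]}}$ denotes the complete $r$-partite graph $\mathcal{K}_{n,\ldots,n}$ with $r$ parts each of size $n$.
   Context: Graphs are finite, simple and undirected. For a graph $\mathcal{G}=(\mathcal{V},\mathcal{E})$ and positive integers $\alpha,\beta$, an $(\alpha\mid\beta)$-cointersection representation (CIR) of $\mathcal{G}$ consists of two disjoint finite sets of features $\mathcal{A},\mathcal{B}$ with $|\mathcal{A}|=\alpha$, $|\mathcal{B}|=\beta$, together with an assignment to each vertex $v$ of subsets $A_v\subseteq\mathcal{A}$, $B_v\subseteq\mathcal{B}$ (possibly empty), such that for all distinct $u,v\in\mathcal{V}$: $(u,v)\in\mathcal{E}$ if and only if $A_u\cap A_v\neq\varnothing$ and $B_u\cap B_v\neq\varnothing$. The cointersection number $\theta^{c}(\mathcal{G})$ is the minimum of $\alpha+\beta$ over all CIRs of $\mathcal{G}$. For $m\ge k\ge 2$, a $2$-$(m,k,1)$ packing is a pair $(\mathcal{X},\mathcal{S})$ where $\mathcal{X}$ is a set of $m$ points and $\mathcal{S}$ is a collection of $k$-element subsets of $\mathcal{X}$ (blocks) such that every pair of distinct points is contained in at most one block. It is resolvable if $\mathcal{S}$ can be partitioned into parallel classes, each consisting of $m/k$ blocks that partition $\mathcal{X}$. *)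

(* Defs.v *)
From mathcomp Require Import all_boot.
From mathcomp Require Import boolp.

Set Implicit Arguments.
Unset Strict Implicit.
Unset Printing Implicit Defensive.

Record sgraph := SGraph {
  vertex :> finType;
  adj : rel vertex;
  adj_sym : symmetric adj;
  adj_irrefl : irreflexive adj }.

(* [F] is an ambient finite type in which the two feature sets live. *)
Definition is_cir (G : sgraph) (F : finType) (A B : {set F})
    (fA fB : G -> {set F}) : Prop :=
  [/\ [disjoint A & B],
      forall v, fA v \subset A,
      forall v, fB v \subset B
    & forall u v, u != v ->
        adj u v <-> fA u :&: fA v != set0 /\ fB u :&: fB v != set0].

Definition has_cir (G : sgraph) (alpha beta : nat) : Prop :=
  0 < alpha /\ 0 < beta /\
  exists (F : finType) (A B : {set F}) (fA fB : G -> {set F}),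
    [/\ #|A| = alpha, #|B| = beta & is_cir A B fA fB].

Definition has_cir_total (G : sgraph) (t : nat) : Prop :=
  exists alpha beta, has_cir G alpha beta /\ t = alpha + beta.

(* One feature in [A] for each clique, and a single feature in [B]. *)
Lemma ex_cir_total (G : sgraph) : exists t, `[< has_cir_total G t >].
Proof.
pose clique (e : {set G}) := [forall x in e, forall y in e, (x != y) ==> adj x y].
pose fA (v : G) : {set option {set G}} :=
  [set o : option {set G} | if o is Some e then (v \in e) && clique e else false].
pose A : {set option {set G}} := [set~ None].
pose B : {set option {set G}} := [set None].
exists (#|A| + #|B|); apply/asboolP; exists #|A|, #|B|; split=> //.
split; first by apply/card_gt0P; exists (Some set0); rewrite !inE.
split; first by rewrite cards1.
exists (option {set G} : finType), A, B, fA, (fun _ => B); split=> //; split=> //.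
- by rewrite -setI_eq0; apply/eqP/setP => o; rewrite !inE andNb.
- by move=> v; apply/subsetP => -[e|]; rewrite !inE.
move=> u v uv; split=> [auv|[/set0Pn[o] + _]].
  split; apply/set0Pn; last by exists None; rewrite !inE.
  exists (Some [set u; v]); rewrite !inE !eqxx orbT /= andbb.
  apply/forall_inP => x /set2P[]->; apply/forall_inP => y /set2P[]->;
    by rewrite ?eqxx // ?auv ?(adj_sym v) ?auv implybT.
case: o => [e|]; rewrite !inE //= => /andP[/andP[ue ce] /andP[ve _]].
by have /forall_inP/(_ v ve)/implyP/(_ uv) := forall_inP ce u ue.
Qed.

Definition cointersection_number (G : sgraph) : nat := ex_minn (ex_cir_total G).

Definition multipartite_adj (r n : nat) : rel ('I_r * 'I_n) :=
  fun u v => u.1 != v.1.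

Lemma multipartite_sym r n : symmetric (@multipartite_adj r n).
Proof. by move=> u v; rewrite /multipartite_adj eq_sym. Qed.

Lemma multipartite_irrefl r n : irreflexive (@multipartite_adj r n).
Proof. by move=> u; rewrite /multipartite_adj eqxx. Qed.

(* The vertex [(i, a)] is the [a]-th vertex of the [i]-th part. *)
Definition complete_multipartite (r n : nat) : sgraph :=
  SGraph (@multipartite_sym r n) (@multipartite_irrefl r n).

(* Blocks form a set rather than a multiset: as [2 <= k], a repeated block
   would contain a pair of points lying in two blocks. *)
Definition packing (m k : nat) (X : finType) (S : {set {set X}}) : Prop :=
  [/\ 2 <= k <= m,
      #|X| = m,
      forall b, b \in S -> #|b| = k
    & forall x y : X, x != y ->
        #|[set b in S | (x \in b) && (y \in b)]| <= 1].

Definition parallel_class (m k : nat) (X : finType) (P : {set {set X}}) : Prop :=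
  partition P [set: X] /\ #|P| * k = m.

Definition resolution (m k : nat) (X : finType) (S : {set {set X}})
    (C : {set {set {set X}}}) : Prop :=
  partition C S /\ forall P, P \in C -> parallel_class m k P.

(* Main.v *)
Require Import Defs.
From mathcomp Require Import all_boot.
From mathcomp Require Import boolp.

Set Implicit Arguments.
Unset Strict Implicit.
Unset Printing Implicit Defensive.

(** Lower bound: the rectangles A_v x B_v are pairwise disjoint within a part,
    while rectangles of different parts meet.  Taking a common point of the
    rectangles of u and v, for u and v running over two parts, gives n^2
    distinct points of A x B; hence |A| |B| >= n^2 and |A| + |B| >= 2n.
    Upper bound: take two copies of the point set as features and let the
    vertices of the i-th part be the k^2 pairs of blocks of the i-th parallel
    class.  Blocks of the same class are equal or disjoint, and blocks of
    different classes always meet: the k points of one lie in distinct blocks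
    of the other class, which has only k blocks. *)

Lemma cir_card_mul r n alpha beta :
  1 < r -> has_cir (complete_multipartite r n) alpha beta ->
  n * n <= alpha * beta.
Proof.
case: r => [|[|r]] // _ [_ [_ [F [A [B [fA [fB [<- <- [_ sA sB adjP]]]]]]]]].
pose rect (v : complete_multipartite r.+2 n) := setX (fA v) (fB v).
(* Two parts suffice; with [r.+2] parts, [ord0] and [ord_max] are distinct. *)
pose v0 (a : 'I_n) : complete_multipartite r.+2 n := (ord0, a).
pose v1 (a : 'I_n) : complete_multipartite r.+2 n := (ord_max, a).
have meet a b : exists z, z \in rect (v0 a) :&: rect (v1 b).
  have [|+ _] := adjP (v0 a) (v1 b); first by rewrite xpair_eqE.
  case=> // /set0Pn[x /setIP[xa xb]] /set0Pn[y /setIP[ya yb]].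
  by exists (x, y); rewrite !inE /= xa xb ya yb.
(* The coordinates of a common point [z] are a shared feature on each side, which would make
   distinct vertices [v a] and [v b] adjacent. *)
have part_uniq (v : 'I_n -> complete_multipartite r.+2 n) z a b :
    (forall a b, ~~ adj (v a) (v b)) -> (forall a, (v a).2 = a) ->
    z \in rect (v a) -> z \in rect (v b) -> a = b.
  move=> nadj v2; rewrite !inE => /andP[xa ya] /andP[xb yb].
  apply/eqP/contraT => ab; have /negP[] := nadj a b.
  apply/adjP; first by apply: contra ab => /eqP vab; rewrite -(v2 a) vab v2.
  by split; apply/set0Pn; [exists z.1 | exists z.2]; rewrite inE ?xa ?ya.
pose f (p : 'I_n * 'I_n) := xchoose (meet p.1 p.2).
have fP p : f p \in rect (v0 p.1) :&: rect (v1 p.2) := xchooseP (meet p.1 p.2).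
have f_inj : injective f.
  move=> [a b] [c d] fE; have /setIP[/= a0 b1] := fP (a, b).
  have /setIP[/= c0 d1] := fP (c, d); rewrite -fE in c0 d1.
  congr pair; [apply: (part_uniq v0) a0 c0 | apply: (part_uniq v1) b1 d1] => //;
    by move=> *; rewrite //= /multipartite_adj eqxx.
rewrite -cardsX -[n in n * _]card_ord -[n in _ * n]card_ord -card_prod.
rewrite -cardsT -(card_imset _ f_inj); apply/subset_leq_card/subsetP.
move=> _ /imsetP[p _ ->]; have /setIP[+ _] := fP p.
by rewrite !inE => /andP[/(subsetP (sA _))-> /(subsetP (sB _))->].
Qed.

(** Compare squares: AM-GM gives [4 * (a * b) <= (a + b) ^ 2]. *)
Lemma double_leq_add n a b : n * n <= a * b -> 2 * n <= a + b.
Proof.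
move=> nab; rewrite -leq_sqr expnMn; apply: leq_trans (nat_AGM2 a b).
by rewrite leq_mul2l -mulnn nab.
Qed.

(** Pigeonhole: sending a point of [b] to its block in [Q] is injective; if [b] missed [c], the
    image would avoid [c], forcing [#|b| < #|Q|]. *)
Lemma partition_meet (X : finType) (Q : {set {set X}}) (b c : {set X}) :
  partition Q [set: X] -> c \in Q -> #|Q| <= #|b| ->
  (forall d, d \in Q -> #|b :&: d| <= 1) -> b :&: c != set0.
Proof.
move=> Qpart cQ leQb meet1; apply/negP => /eqP bc0.
have covQ x : x \in cover Q by rewrite (cover_partition Qpart).
have pblockQ x : pblock Q x \in Q by rewrite pblock_mem.
suff: #|b| < #|Q| by rewrite ltnNge leQb.
rewrite (cardsD1 c Q) cQ ltnS -(@card_in_imset _ _ (pblock Q)); last first.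
  move=> x y xb yb xy; apply: (card_le1_eqP (meet1 _ (pblockQ x))).
    by rewrite inE yb xy mem_pblock covQ.
  by rewrite inE xb mem_pblock covQ.
apply/subset_leq_card/subsetP => _ /imsetP[x xb ->].
rewrite !inE pblockQ andbT; apply: contra_eq_neq bc0 => <-.
by apply/set0Pn; exists x; rewrite inE xb mem_pblock covQ.
Qed.

Lemma packing_meet_le1 m k (X : finType) (S : {set {set X}}) b c :
  packing m k S -> b \in S -> c \in S -> b != c -> #|b :&: c| <= 1.
Proof.
move=> [_ _ _ pairP] bS cS bc; apply/card_le1_eqP => x y.
move=> /setIP[xb xc] /setIP[yb yc]; apply/eqP/contraT => xy.
rewrite eq_sym in xy.
suff: b = c by move/eqP; rewrite (negPf bc).
by apply: (card_le1_eqP (pairP _ _ xy)); rewrite !inE ?bS ?cS ?xb ?xc ?yb ?yc.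
Qed.

Section BlockPairs.

Variables (k : nat) (X : finType) (S : {set {set X}}) (C : {set {set {set X}}}).
Hypotheses (packS : packing (k ^ 2) k S) (resS : resolution (k ^ 2) k S C).

Lemma class_card P : P \in C -> #|P| = k.
Proof.
have [/andP[k2 _] _ _ _] := packS.
move=> /(proj2 resS)[_] /eqP; rewrite -mulnn eqn_pmul2r ?(ltnW k2) //.
by move=> /eqP.
Qed.

Lemma class_sub P b : P \in C -> b \in P -> b \in S.
Proof.
by move=> PC bP; rewrite -(cover_partition resS.1); apply/bigcupP; exists P.
Qed.

Lemma class_meet P Q b c : P \in C -> Q \in C -> P != Q ->
  b \in P -> c \in Q -> b :&: c != set0.
Proof.
move=> PC QC PQ bP cQ; have bS := class_sub PC bP.
apply: (@partition_meet _ Q) => //; first by have [] := resS.2 _ QC.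
  by have [_ _ cardS _] := packS; rewrite class_card ?cardS.
move=> d dQ; apply: (packing_meet_le1 packS) (class_sub QC dQ) _ => //.
(* Distinct classes are disjoint as sets of blocks, so [b] is not in [Q] and differs from [d]. *)
have /and3P[_ /trivIsetP/(_ _ _ PC QC PQ) /disjointFr/(_ bP) bQ _] := resS.1.
by apply: contraFneq bQ => ->.
Qed.

Lemma class_eq P b c : P \in C -> b \in P -> c \in P ->
  b :&: c != set0 -> b = c.
Proof.
move=> PC bP cP bc; have [/and3P[_ /trivIsetP trivP _] _] := resS.2 _ PC.
by apply: contraNeq bc => /(trivP _ _ bP cP); rewrite -setI_eq0.
Qed.

Lemma has_cir_resolvable r : r <= #|C| ->
  has_cir (complete_multipartite r (k ^ 2)) (k ^ 2) (k ^ 2).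
Proof.
move=> rC; have [/andP[k2 _] cardX _ _] := packS.
have k_gt0 := ltnW k2.
split; first by rewrite expn_gt0 k_gt0.
split; first by rewrite expn_gt0 k_gt0.
pose cls (i : 'I_r) : {set {set X}} := enum_val (widen_ord rC i).
have clsC i : cls i \in C := enum_valP _.
pose pairs i := enum (setX (cls i) (cls i)).
have size_pairs i : size (pairs i) = k ^ 2.
  by rewrite -cardE cardsX class_card // mulnn.
(* The default pair is never reached: [pairs v.1] has exactly [k ^ 2] entries. *)
pose g (v : complete_multipartite r (k ^ 2)) := nth (set0, set0) (pairs v.1) v.2.
have gP v : (g v).1 \in cls v.1 /\ (g v).2 \in cls v.1.
  have : g v \in pairs v.1 by rewrite mem_nth ?size_pairs.
  by rewrite mem_enum inE => /andP[].
have inlI : injective (@inl X X) by move=> ? ? [].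
have inrI : injective (@inr X X) by move=> ? ? [].
exists (X + X)%type, (inl @: [set: X]), (inr @: [set: X]).
exists (fun v => inl @: (g v).1), (fun v => inr @: (g v).2).
split; rewrite ?card_imset ?cardsT //; split.
- by rewrite -setI_eq0; apply/set0Pn => -[_ /setIP[/imsetP[x _ ->] /imsetP[]]].
- by move=> v; apply/imsetS/subsetT.
- by move=> v; apply/imsetS/subsetT.
move=> u v uv; rewrite -!imsetI; try by move=> ? ? _ _ [].
rewrite !imset_eq0.
have [gu1 gu2] := gP u; have [gv1 gv2] := gP v; split=> [auv | [m1 m2]].
  have cuv : cls u.1 != cls v.1.
    by apply: contra auv => /eqP /enum_val_inj [/val_inj ->].
  by split; apply: class_meet cuv _ _.
(* Within one part, meeting in both coordinates forces equal block pairs; the enumeration has no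
   repetition, so the indices agree and [u = v]. *)
rewrite /adj /= /multipartite_adj; apply: contra uv => /eqP uv1.
rewrite -uv1 in gv1 gv2.
have guv : g u = g v.
  rewrite [g u]surjective_pairing [g v]surjective_pairing.
  by congr pair; apply: class_eq (clsC u.1) _ _ _.
rewrite -pair_eqE /= /pair_eq uv1 eqxx /=; move/eqP: guv.
by rewrite /g uv1 nth_uniq ?size_pairs ?enum_uniq.
Qed.

End BlockPairs.

Theorem theorem6 (k r n : nat) (hk : 2 <= k) (hr : 2 <= r) (hn : n = k ^ 2)
  (hpack : exists (X : finType) (S : {set {set X}}) (C : {set {set {set X}}}),
     [/\ packing (k ^ 2) k S, resolution (k ^ 2) k S C & r <= #|C|]) :
  cointersection_number (complete_multipartite r n) = 2 * n.
Proof.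
rewrite /cointersection_number; case: ex_minnP => t /asboolP cir_t t_min.
apply/eqP; rewrite eqn_leq; apply/andP; split.
  have [X [S [C [packS resS rC]]]] := hpack.
  apply/t_min/asboolP; exists n, n; rewrite mul2n -addnn hn; split=> //.
  exact: has_cir_resolvable packS resS _ rC.
have [alpha [beta [cir ->]]] := cir_t.
exact/double_leq_add/(cir_card_mul hr cir).
Qed.
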